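(* Let $\alpha\geq1$ be rational. Let $\mathcal K^+$ be the class of all finite structures in the language $\{\mathfrak R,\prec\}$ whose $\mathfrak R$-reduct is a graph in $\mathcal K_\alpha^+$ and in which $\prec$ is a linear ordering, and for $E,F\in\mathcal K^+$ put $E\leqslant^+F$ iff $E$ is a substructure of $F$ and the $\mathfrak R$-reducts satisfy $E\leqslant_\alpha F$. Let $\mathbf M^+$ be the $(\mathcal K^+,\leqslant^+)$-generic structure (the ordered Hrushovski generic structure for the pre-dimension $\delta_\alpha$). Then $\mathrm{Aut}(\mathbf M^+)$, with the pointwise convergence topology, is not extremely amenable.
   Context: $\mathfrak R$ is a binary (graph) relation. $\delta_\alpha(A)=\alpha|V(A)|-|E(A)|$; $A\leqslant_\alpha B$ iff $\delta_\alpha(C)\geq\delta_\alpha(A)$ for all $A\subseteq C\subseteq B$; $\mathcal K_\alpha^+$ is the class of finite graphs all of whose subgraphs have $\delta_\alpha\geq0$. For a smooth class $(\mathcal C,\preceq)$, with $A\preceq N$ for infinite $N$ meaning $A\preceq B$ for all finite substructures $B\supseteq A$ of $N$, the generic structure is the unique countable $\mathbf N$ with age $\mathcal C$, union of a chain $A_0\preceq A_1\preceq\cdots$ in $\mathcal C$, such that for finite $A\preceq\mathbf N$ and $A\preceq B\in\mathcal C$ some embedding of $B$ into $\mathbf N$ over $A$ has image $\preceq\mathbf N$. Extremely amenable: every continuous action on a compact Hausdorff space has a fixed point. *)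

(* Defs.v *)
From HB Require Import structures.
From mathcomp Require Import all_boot all_order all_algebra finmap.
From mathcomp Require Import mathcomp_extra boolp classical_sets functions.
From mathcomp Require Import topology.

Set Implicit Arguments.
Unset Strict Implicit.
Unset Printing Implicit Defensive.

Import Order.TTheory GRing.Theory Num.Theory.

Local Open Scope ring_scope.

(* Structures in the language {R, <} with two binary relation symbols. *)
Record structure (T : Type) := Structure { adj : rel T; prec : rel T }.

(* The structure pulled back along f; for an inclusion, the substructure. *)
Definition pullback (S T : Type) (f : S -> T) (M : structure T) : structure S :=
  Structure (relpre f (adj M)) (relpre f (prec M)).

Definition substructure (T : choiceType) (M : structure T) (A : {fset T}) :
  structure A := pullback val M.

Definition embedding (S T : Type) (G : structure S) (H : structure T)
    (f : S -> T) : Prop :=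
  [/\ injective f,
      {mono f : x y / adj G x y >-> adj H x y} &
      {mono f : x y / prec G x y >-> prec H x y}].

Section Predimension.
Variables (alpha : rat) (F : finType) (e : rel F).

Definition graph_rel : Prop := symmetric e /\ irreflexive e.

(* Edges of the subgraph induced on S, as unordered pairs. *)
Definition edges (S : {set F}) : {set {set F}} :=
  [set [set x; y] | x in S, y in S & e x y].

Definition delta (S : {set F}) : rat := alpha * #|S|%:R - #|edges S|%:R.

Definition K_alpha : Prop := graph_rel /\ forall S : {set F}, 0 <= delta S.

(* The subgraph induced on A is self-sufficient in the graph (F, e). *)
Definition le_alpha (A : {set F}) : Prop :=
  forall C : {set F}, A \subset C -> delta A <= delta C.

End Predimension.

Definition strict_linear_order (T : eqType) (r : rel T) : Prop :=
  [/\ irreflexive r, transitive r & forall x y, x != y -> r x y || r y x].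

Definition K_plus (alpha : rat) (F : finType) (G : structure F) : Prop :=
  K_alpha alpha (adj G) /\ strict_linear_order (prec G).

Definition le_plus (alpha : rat) (F : finType) (G : structure F)
  (E : {set F}) : Prop := le_alpha alpha (adj G) E.

Section Generic.
(* A class of finite structures, and the relation "the substructure of G with
   domain E is strong in G". *)
Variable C : forall F : finType, structure F -> Prop.
Variable strong : forall F : finType, structure F -> {set F} -> Prop.
Variables (T : countType) (M : structure T).

Definition strong_fset (A B : {fset T}) : Prop :=
  (A `<=` B)%fset /\ strong (substructure M B) [set x : B | val x \in A].

Definition strong_in (A : {fset T}) : Prop :=
  forall B : {fset T}, (A `<=` B)%fset -> strong_fset A B.

Definition has_age : Prop :=
  (forall A : {fset T}, C (substructure M A)) /\
  (forall (F : finType) (G : structure F), C G ->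
     exists f : F -> T, embedding G M f).

Definition union_of_chain : Prop :=
  exists A : nat -> {fset T},
    [/\ forall i, C (substructure M (A i)),
        forall i, strong_fset (A i) (A i.+1) &
        forall x, exists i, x \in A i].

Definition extension_property : Prop :=
  forall A : {fset T}, strong_in A ->
  forall (B : finType) (H : structure B), C H ->
  forall f : A -> B, embedding (substructure M A) H f ->
    strong H [set f a | a : A] ->
  exists g : B -> T,
    [/\ embedding H M g,
        forall a : A, g (f a) = val a &
        strong_in [fset g b | b : B]%fset].

Definition is_generic : Prop :=
  [/\ has_age, union_of_chain & extension_property].

End Generic.

HB.mixin Record isTopologicalGroup G of Group G & Topological G := {
  mulg_continuous : continuous (fun p : G * G => (p.1 * p.2)%g);
  invg_continuous : continuous (fun g : G => (g^-1)%g)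
}.

#[short(type="topologicalGroupType")]
HB.structure Definition TopologicalGroup :=
  {G of Group G & Topological G & isTopologicalGroup G}.

Definition continuous_action (G : topologicalGroupType) (X : topologicalType)
    (act : G -> X -> X) : Prop :=
  [/\ forall x, act 1%g x = x,
      forall g h x, act (g * h)%g x = act g (act h x) &
      continuous (fun p : G * X => act p.1 p.2)].

(* Compact spaces are nonempty here: on the empty space there is no point to
   be fixed. *)
Definition extremely_amenable (G : topologicalGroupType) : Prop :=
  forall (X : topologicalType) (act : G -> X -> X),
    ([set: X] !=set0)%classic -> compact [set: X]%classic ->
    hausdorff_space X -> continuous_action act ->
  exists x : X, forall g : G, act g x = x.

Section Automorphisms.
Variables (T : choiceType) (M : structure T).

Definition is_automorphism (f : T -> T) : Prop :=
  [/\ bijective f,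
      {mono f : x y / adj M x y} & {mono f : x y / prec M x y}].

(* The subspace of the space of all functions T -> T with the topology of
   pointwise convergence, T being discrete. *)
Definition Aut : Type :=
  set_type ([set f | is_automorphism f]%classic
              : set {ptws T -> discrete_topology T}).

HB.instance Definition _ := Topological.on Aut.

Definition aut_fun (g : Aut) : T -> T := val g.
Coercion aut_fun : Aut >-> Funclass.

Lemma autP (g : Aut) : is_automorphism g.
Proof. exact: (set_valP g). Qed.

Definition mk_aut (f : T -> T) (Hf : is_automorphism f) : Aut :=
  SigSub (mem_set Hf).

Lemma aut_eq (g h : Aut) : g =1 h -> g = h.
Proof. by move=> gh; apply: val_inj; apply: funext. Qed.

Fact aut1_subproof : is_automorphism id.
Proof. by split=> //; exists id. Qed.

Fact autM_subproof (g h : Aut) : is_automorphism (g \o h).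
Proof.
have [bg ag pg] := autP g; have [bh ah ph] := autP h.
by split=> [|x y|x y]; [exact: bij_comp|rewrite /= ag ah|rewrite /= pg ph].
Qed.

Fact autV_ex (g : Aut) :
  exists h : T -> T, [/\ is_automorphism h, cancel g h & cancel h g].
Proof.
have [[h gh hg] ag pg] := autP g; exists h; split=> //.
split=> [|x y|x y]; first by exists g.
- by rewrite -ag !hg.
- by rewrite -pg !hg.
Qed.

Definition aut1 : Aut := mk_aut aut1_subproof.
Definition autM (g h : Aut) : Aut := mk_aut (autM_subproof g h).
Definition autV (g : Aut) : Aut :=
  mk_aut (let: And3 Hh _ _ := projT2 (cid (autV_ex g)) in Hh).

Fact autVK (g : Aut) : cancel g (autV g) /\ cancel (autV g) g.
Proof. by have [_ gh hg] := projT2 (cid (autV_ex g)); split. Qed.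

Fact autMA : associative autM. Proof. by move=> f g h; apply: aut_eq. Qed.
Fact aut1M : left_id aut1 autM. Proof. by move=> g; apply: aut_eq. Qed.
Fact autM1 : right_id aut1 autM. Proof. by move=> g; apply: aut_eq. Qed.
Fact autVM : left_inverse aut1 autV autM.
Proof. by move=> g; apply: aut_eq; exact: (autVK g).1. Qed.
Fact autMV : right_inverse aut1 autV autM.
Proof. by move=> g; apply: aut_eq; exact: (autVK g).2. Qed.

HB.instance Definition _ := isGroup.Build Aut autMA aut1M autM1 autVM autMV.

Fact near_aut (g : Aut) (x : T) : nbhs g [set h : Aut | h x = g x]%classic.
Proof.
pose K := fun _ : T => discrete_topology T.
have cx : continuous (fun h : Aut => (val h : {ptws T -> discrete_topology T}) x).
  move=> h; apply: (@continuous_comp _ _ _ (val : Aut -> prod_topology K) (@proj T K x)).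
    exact: initial_continuous.
  exact: proj_continuous.
exact: (cx g _ (discrete_set1 _)).
Qed.

Fact cvg_aut (F : set_system Aut) (g : Aut) : Filter F ->
  (forall x, F [set h : Aut | h x = g x]%classic) -> (F --> g)%classic.
Proof.
move=> FF Fg U [_ /= [[V oV <-] Vg VU]].
have: (val @ F --> (val g : {ptws T -> discrete_topology T}))%classic.
  apply/cvg_sup => x W [_ /= [[Z oZ <-] Zg ZW]].
  apply: filterS (Fg x) => h hx; apply: ZW.
  have {}hx : h x = g x := hx.
  by change (Z (h x)); rewrite hx; exact: Zg.
move=> /(_ V (open_nbhs_nbhs (conj oV Vg))) FV.
by apply: filterS VU _; exact: FV.
Qed.

Fact autM_continuous : continuous (fun p : Aut * Aut => (p.1 * p.2)%g).
Proof.
case=> g0 h0; pose g : Aut := g0; pose h : Aut := h0.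
apply: (@cvg_aut _ (autM g h)) => x.
exists ([set g' : Aut | g' (h x) = g (h x)]%classic, [set h' : Aut | h' x = h x]%classic).
  by split; exact: near_aut.
case=> g' h' [g'E h'E].
have {}g'E : aut_fun g' (h x) = g (h x) := g'E.
have {}h'E : aut_fun h' x = h x := h'E.
by change (aut_fun g' (aut_fun h' x) = g (h x)); rewrite h'E.
Qed.

Fact autV_continuous : continuous (fun g : Aut => (g^-1)%g).
Proof.
move=> g0; pose g : Aut := g0.
apply: (@cvg_aut _ (autV g) (fmap_filter _ (nbhs_filter g))) => x.
apply: filterS (near_aut g (autV g x)) => h hE.
have {}hE : h (autV g x) = g (autV g x) := hE.
have [hK hK'] := autVK h; have [_ gK] := autVK g.
by change (autV h x = autV g x); apply: (can_inj hK); rewrite hE hK' gK.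
Qed.

HB.instance Definition _ :=
  isTopologicalGroup.Build Aut autM_continuous autV_continuous.

End Automorphisms.

(* Main.v *)
Require Import Defs.
From HB Require Import structures.
From mathcomp Require Import all_boot all_order all_algebra finmap.
From mathcomp Require Import boolp classical_sets topology lra.

(* The compact space acted upon is the space of orientations of the edges of M
   with all out-degrees at most k, where k >= 2 alpha.  It is nonempty by
   compactness: a finite graph with |E(S)| <= alpha |S| for all S always has a
   vertex of degree at most 2 alpha; orient its edges outwards, delete it and
   iterate.  A fixed point is an Aut(M)-invariant orientation.  By back-and-forth
   all strongly embedded edges x < y are conjugate under Aut(M), so an invariant
   orientation directs all of them upwards or all of them downwards.  But since
   alpha >= 1, a star with k + 1 leaves has strong edges and embeds strongly in
   M, both with its center below and with its center above the leaves; one of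
   these two centers has out-degree at least k + 1. *)

Set Implicit Arguments.
Unset Strict Implicit.
Unset Printing Implicit Defensive.

Import Order.TTheory GRing.Theory Num.Theory.
Local Open Scope ring_scope.

(** * Pre-dimension and bounded orientations of finite graphs *)

Section FinitePredimension.
Variables (alpha : rat) (F : finType) (e : rel F).
Implicit Types (S A B : {set F}).

Lemma edgesP S p :
  reflect (exists x y, [/\ x \in S, y \in S, e x y & p = [set x; y]])
          (p \in edges e S).
Proof.
apply: (iffP imset2P) => [[x y xS /[!inE]/andP[yS exy] ->]|[x [y [xS yS exy ->]]]].
  by exists x, y.
by exists x y => //; rewrite inE yS.
Qed.

(** Vertex counts are modular and edge counts supermodular: an edge inside [A] or inside [B] is an
    edge of the union, and one inside both is an edge of the intersection. *)
Lemma delta_submodular A B :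
  delta alpha e (A :|: B) + delta alpha e (A :&: B) <=
  delta alpha e A + delta alpha e B.
Proof.
have cV := cardsUI A B.
have cE := cardsUI (edges e A) (edges e B).
have leU : (#|edges e A :|: edges e B| <= #|edges e (A :|: B)|)%N.
  apply/subset_leq_card/fintype.subsetP => p; rewrite inE.
  by move=> /orP[] /edgesP[x [y [xS yS exy ->]]]; apply/edgesP; exists x, y; rewrite !inE xS yS ?orbT.
have leI : (#|edges e A :&: edges e B| <= #|edges e (A :&: B)|)%N.
  apply/subset_leq_card/fintype.subsetP => p; rewrite inE.
  move=> /andP[/edgesP[x [y [xA yA exy ->]]] /edgesP[x' [y' [xB yB _ E]]]].
  have sB z : z \in [set x; y] -> z \in B by rewrite E !inE => /orP[] /eqP->.
  by apply/edgesP; exists x, y; rewrite !inE xA yA !sB // !inE eqxx ?orbT.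
have {}cV : #|A :|: B|%:R + #|A :&: B|%:R = #|A|%:R + #|B|%:R :> rat
  by rewrite -!natrD cV.
have lE : (#|edges e A| + #|edges e B| <=
           #|edges e (A :|: B)| + #|edges e (A :&: B)|)%N by rewrite -cE leq_add.
have {}lE : #|edges e A|%:R + #|edges e B|%:R <=
           #|edges e (A :|: B)|%:R + #|edges e (A :&: B)|%:R :> rat.
  by rewrite -!natrD ler_nat.
rewrite /delta; nra.
Qed.

(** Handshake bound: the degree sum counts ordered adjacent pairs, and at most two of them give the
    same unordered edge. *)
Lemma sum_degrees S :
  (\sum_(x in S) #|[set y in S | e x y]| <= 2 * #|edges e S|)%N.
Proof.
pose Q := [set p : F * F | [&& p.1 \in S, p.2 \in S & e p.1 p.2]].
have -> : (\sum_(x in S) #|[set y in S | e x y]| = \sum_(p in Q) 1)%N.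
  rewrite (eq_bigr (fun x => \sum_(y in [set y in S | e x y]) 1)%N); last first.
    by move=> x _; rewrite sum1_card.
  by rewrite pair_big_dep /=; apply: eq_bigl => p; rewrite !inE.
rewrite (partition_big (fun p => [set p.1; p.2]) (mem (edges e S))) /=; last first.
  move=> [x y] /[!inE] /and3P[/= xS yS exy]; by apply/edgesP; exists x, y.
rewrite mulnC -sum_nat_const; apply: leq_sum => p /edgesP[x [y [xS yS exy ->]]].
rewrite sum1dep_card.
apply: (@leq_trans #|[set (x, y); (y, x)]|); last by rewrite cards2; case: (_ != _).
apply/subset_leq_card/fintype.subsetP => -[a b] /[!inE] /andP[/and3P[/= _ _ eab] /eqP E].
have [xab yab] : x \in [set a; b] /\ y \in [set a; b] by rewrite E set21 set22.
have [axy bxy] : a \in [set x; y] /\ b \in [set x; y] by rewrite -E set21 set22.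
clear E; rewrite !inE !xpair_eqE in xab yab axy bxy *.
case/orP: axy => /eqP ?; case/orP: bxy => /eqP ?; subst a b; rewrite ?eqxx ?orbT //.
- by rewrite !orbb in yab *; rewrite eq_sym yab.
- by rewrite !orbb in xab *; rewrite eq_sym xab.
Qed.

Variable k : nat.
Hypothesis k_ge : 2 * alpha <= k%:R.
Hypothesis delta_ge0 : forall S, 0 <= delta alpha e S.

(** Averaging: if all degrees in [S] exceeded [k], then (k + 1)|S| <= 2|E(S)| <= 2 alpha |S| <=
    k|S|, impossible for nonempty [S]. *)
Lemma low_degree_vertex S : S != finset.set0 ->
  exists2 v, v \in S & (#|[set y in S | e v y]| <= k)%N.
Proof.
move=> S0; apply: contrapT => noV.
have deg v : v \in S -> (k < #|[set y in S | e v y]|)%N.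
  by move=> vS; rewrite ltnNge; apply/negP => ?; apply: noV; exists v.
have S_gt0 : (0 < #|S|)%N by rewrite card_gt0.
have: (\sum_(v in S) k.+1 <= 2 * #|edges e S|)%N.
  by apply: leq_trans (sum_degrees S); apply: leq_sum.
rewrite sum_nat_const -(ler_nat rat) !natrM.
have := delta_ge0 S; rewrite /delta -(natr1 k).
have s_gt0 : 0 < #|S|%:R :> rat by rewrite ltr0n.
have : 2 * alpha * #|S|%:R <= k%:R * #|S|%:R by rewrite ler_pM2r.
by move: #|S|%:R #|edges e S|%:R s_gt0 => s E ? ? ? ?; lra.
Qed.

Lemma bounded_orientation S : symmetric e ->
  exists o : rel F,
    {in S &, forall x y, e x y -> o x y || o y x} /\
    forall x, (#|[set y | o x y]| <= k)%N.
Proof.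
move=> esym.
have [n] := ubnP #|S|; elim: n S => // n IH S ltS.
have [->|S0] := eqVneq S finset.set0.
  exists (fun _ _ => false); split=> [x y|x]; first by rewrite inE.
  by rewrite (_ : [set _ | _] = finset.set0) ?cards0 //; apply/setP => y; rewrite !inE.
have [v vS degv] := low_degree_vertex S0.
have [|o [oE odeg]] := IH (S :\ v).
  by move: ltS; rewrite (cardsD1 v S) vS.
(* All edges from [v] into [S] leave [v], at most [k] by its choice; the other vertices keep their
   out-neighbours under [o]. *)
exists (fun x y => if x == v then (y \in S) && e v y else o x y); split.
  move=> x y xS yS exy; have [xv|xv] := eqVneq x v.
    by rewrite yS -xv exy.
  have [yv|yv] := eqVneq y v; first by rewrite xS -yv esym exy orbT.
  by apply: oE => //; rewrite !inE ?xv ?yv.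
by move=> x; case: (x == v).
Qed.

End FinitePredimension.

Lemma delta_imset (alpha : rat) (F F' : finType) (e : rel F) (e' : rel F')
    (f : F -> F') (S : {set F}) :
  injective f -> {mono f : x y / e x y >-> e' x y} ->
  delta alpha e' (f @: S) = delta alpha e S.
Proof.
move=> fI fE; rewrite /delta card_imset //; congr (_ - _%:R).
rewrite (_ : edges e' _ = [set f @: p | p : {set F} in edges e S]).
  by rewrite card_imset //; exact: imset_inj.
apply/setP => p; apply/edgesP/imsetP => [[_ [_ [/imsetP[x xS ->] /imsetP[y yS ->]]]]|].
  rewrite fE => exy ->; exists [set x; y]; last by rewrite imsetU1 imset_set1.
  by apply/edgesP; exists x, y.
move=> [_ /edgesP[x [y [xS yS exy ->]]] ->]; exists (f x), (f y).
by rewrite !imset_f // fE exy imsetU1 imset_set1.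
Qed.

(* The star on [n.+1] vertices with center [ord0], the center being the least
   or the greatest vertex according to [b]. *)
Definition star (b : bool) (n : nat) : structure 'I_n.+1 :=
  Structure (fun i j => (i == ord0) != (j == ord0))
            (fun i j => if b then (i < j)%N else (j < i)%N).

(** * Stars: membership in the class and strong edges *)

Section Star.
Variables (alpha : rat) (b : bool) (n : nat).
Hypothesis alpha_ge1 : 1 <= alpha.
Local Notation e := (adj (star b n)).

(** Every edge contains the center and is determined by its leaf, so there are none when the center
    is missing from [S]. *)
Lemma star_edges (S : {set 'I_n.+1}) : (#|edges e S| <= #|S|.-1)%N.
Proof.
have [z|z] := boolP (ord0 \in S).
  rewrite (cardsD1 ord0 S) z /=.
  apply: leq_trans (leq_imset_card (fun i => [set ord0; i]) _).
  apply/subset_leq_card/fintype.subsetP => p /edgesP[x [y [xS yS exy ->]]].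
  move: exy => /=; have [->|x0] := eqVneq x ord0; have [->|y0] //= := eqVneq y ord0 => _.
    by apply/imsetP; exists y; rewrite // !inE y0.
  by rewrite finset.setUC; apply/imsetP; exists x; rewrite // !inE x0.
rewrite (_ : edges _ _ = finset.set0) ?cards0 //; apply/setP => p; rewrite inE.
apply/negP => /edgesP[x [y [xS yS]]] /=.
by have [x0|x0] := eqVneq x ord0; have [y0|y0] //= := eqVneq y ord0;
  rewrite ?x0 ?y0 in xS yS; rewrite ?(negPf z) in xS yS.
Qed.

(** With at most |S| - 1 edges, delta(S) >= (alpha - 1)|S| + 1, which is monotone in |S| because
    alpha >= 1. The case m = 1 puts stars in the class; for m = 2 the bound is 2 alpha - 1, the
    pre-dimension of an edge. *)
Lemma star_delta_ge (S : {set 'I_n.+1}) (m : nat) : (0 < m <= #|S|)%N ->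
  (alpha - 1) * m%:R + 1 <= delta alpha e S.
Proof.
move=> /andP[m0 mS]; rewrite /delta.
have : (#|edges e S|.+1 <= #|S|)%N.
  by rewrite -[X in (_ <= X)%N](@prednK #|S|) ?ltnS ?star_edges // (leq_trans m0).
rewrite -(ler_nat rat) -natr1; move: mS; rewrite -(ler_nat rat) => mS ES.
have : (alpha - 1) * m%:R <= (alpha - 1) * #|S|%:R by rewrite ler_wpM2l // subr_ge0.
lra.
Qed.

Lemma star_K_plus : K_plus alpha (star b n).
Proof.
split; last first.
  split=> [i|j i k|i j ij] /=; first by rewrite ltnn if_same.
    by case: b => [|/[swap]]; exact: ltn_trans.
  by move: ij; rewrite -val_eqE /= neq_ltn; case: b => //; rewrite orbC.
split; first split=> [i j|i] /=; rewrite ?eqxx //.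
  by rewrite eq_sym.
move=> S; have [->|S0] := eqVneq S finset.set0.
  have := star_edges finset.set0; rewrite /delta cards0 leqn0 => /eqP->.
  by rewrite mulr0 subr0.
have := @star_delta_ge S 1; rewrite card_gt0 S0 => /(_ isT).
by apply: le_trans; rewrite mulr1 subrK (le_trans ler01).
Qed.

Lemma star_edge_strong (i : 'I_n.+1) : i != ord0 ->
  le_plus alpha (star b n) [set ord0; i].
Proof.
move=> i0 S sS.
have c2 : #|[set ord0; i]| = 2%N by rewrite cards2 eq_sym i0.
apply: le_trans (@star_delta_ge S 2 _); last by rewrite -c2 subset_leq_card ?c2.
rewrite /delta c2.
have : (1 <= #|edges e [set ord0; i]|)%N.
  apply/card_gt0P; exists [set ord0; i]; apply/edgesP; exists ord0, i.
  by rewrite /= !inE !eqxx orbT (negPf i0).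
rewrite -(ler_nat rat); lra.
Qed.

End Star.

(** * Pre-dimension and strong subsets in a countable structure *)

Section InfiniteStructure.
Variables (alpha : rat) (T : countType) (M : structure T).
Implicit Types (A B C D : {fset T}).

(** Each finite set is measured in its own induced substructure, so that values can be compared
    without a common ambient finite type. *)
Definition fdelta A : rat := delta alpha (adj (substructure M A)) [set: A].

Lemma fdelta_fsub A B : (A `<=` B)%fset ->
  delta alpha (adj (substructure M B)) [set x : B | val x \in A] = fdelta A.
Proof.
move=> sAB; rewrite /fdelta -(@delta_imset _ _ _ _ (adj (substructure M B)) (fincl sAB)) //.
  congr delta; apply/setP => x; rewrite inE; apply/idP/imsetP => [xA|[y _ ->]].
    by exists [` xA]%fset; rewrite ?inE //; apply: val_inj.
  by have := valP y.
exact: fincl_inj.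
Qed.

Lemma fdelta_imfset (F : finType) (G : structure F) (g : F -> T) (S : {set F}) :
  injective g -> {mono g : x y / adj G x y >-> adj M x y} ->
  fdelta [fset g x | x in S]%fset = delta alpha (adj G) S.
Proof.
move=> gI gE; pose E := [fset g x | x : F]%fset.
have gP x : g x \in E by apply/imfsetP; exists x.
have sE : ([fset g x | x in S] `<=` E)%fset.
  by apply/fsubsetP => _ /imfsetP[x _ ->].
rewrite -(fdelta_fsub sE) -(@delta_imset _ _ _ (adj G) (adj (substructure M E))
  (fun x => [` gP x]%fset)) //.
- congr delta; apply/setP => y; rewrite inE; apply/imfsetP/imsetP => -[x xS yx].
    by exists x => //; apply: val_inj.
  by exists x; rewrite // yx.
- by move=> x y /(congr1 val) /gI.
Qed.

Lemma fdelta_submodular A B :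
  fdelta (A `|` B)%fset + fdelta (A `&` B)%fset <= fdelta A + fdelta B.
Proof.
have sI : (A `&` B `<=` A `|` B)%fset by rewrite (fsubset_trans (fsubsetIl _ _)) ?fsubsetUl.
rewrite -(fdelta_fsub sI) -(fdelta_fsub (fsubsetUl A B)) -(fdelta_fsub (fsubsetUr A B)).
have := delta_submodular alpha (adj (substructure M (A `|` B)%fset))
  [set x | val x \in A] [set x | val x \in B].
congr (_ + _ <= _); congr delta; apply/setP => x; rewrite !inE //.
by have := valP x; rewrite !inE.
Qed.

Local Notation strong := (le_plus alpha).

Definition fstrong A B : Prop :=
  (A `<=` B)%fset /\
  forall C, (A `<=` C)%fset -> (C `<=` B)%fset -> fdelta A <= fdelta C.

Lemma strong_fsetE A B : strong_fset strong M A B <-> fstrong A B.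
Proof.
split=> -[sAB st]; split=> // C sAC.
  move=> sCB; rewrite -(fdelta_fsub sAB) -(fdelta_fsub sCB); apply: st.
  by apply/fintype.subsetP => x; rewrite !inE; exact: (fsubsetP sAC).
rewrite (fdelta_fsub sAB) -(@fdelta_imfset B (substructure M B) val C val_inj) //.
apply: st; last by apply/fsubsetP => _ /imfsetP[x _ ->]; exact: valP.
apply/fsubsetP => x xA; have xB := fsubsetP sAB _ xA.
by apply/imfsetP; exists [` xB]%fset => //; apply: (fintype.subsetP sAC); rewrite inE.
Qed.

Lemma strong_inE A :
  strong_in strong M A <-> forall B, (A `<=` B)%fset -> fdelta A <= fdelta B.
Proof.
split=> [st B sAB|st B sAB]; first by have /strong_fsetE[_] := st B sAB; exact.
by apply/strong_fsetE; split=> // C sAC _; exact: st.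
Qed.

(** The form in which submodularity is used: when [B] is strong in a set containing [D], cutting [D]
    down to [B] does not raise the pre-dimension. *)
Lemma fdelta_capl_le B D :
  fdelta B <= fdelta (D `|` B)%fset -> fdelta (D `&` B)%fset <= fdelta D.
Proof. by have := fdelta_submodular D B; lra. Qed.

Lemma fstrong_trans B A C : fstrong A B -> fstrong B C -> fstrong A C.
Proof.
move=> [sAB stA] [sBC stB]; split=> [|D sAD sDC]; first exact: fsubset_trans sBC.
(* The chain to establish is delta(A) <= delta(D ∩ B) <= delta(D). *)
have /fdelta_capl_le : fdelta B <= fdelta (D `|` B)%fset.
  by apply: stB; rewrite ?fsubsetUr // fsubUset sDC.
by apply: le_trans; apply: stA; rewrite ?fsubsetIr // fsubsetI sAD.
Qed.

Lemma fstrong_strong_in A B : fstrong A B -> strong_in strong M B -> strong_in strong M A.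
Proof.
move=> stA stB C sAC; apply/strong_fsetE; split=> // D sAD _.
have [_ ->] // : fstrong A (D `|` B)%fset; last by rewrite fsubsetUl.
by apply: fstrong_trans stA _; apply/strong_fsetE/stB; exact: fsubsetUr.
Qed.

(** * Basic properties of the generic structure *)

Hypothesis M_generic : is_generic (K_plus alpha) strong M.

Lemma generic_adj_sym : symmetric (adj M).
Proof.
move=> x y; have [[/(_ [fset x; y]%fset)[[[sym _] _] _] _] _ _] := M_generic.
have xP : x \in [fset x; y]%fset by rewrite !inE eqxx.
have yP : y \in [fset x; y]%fset by rewrite !inE eqxx orbT.
exact: sym [` xP]%fset [` yP]%fset.
Qed.

Lemma generic_adj_irr : irreflexive (adj M).
Proof.
move=> x; have [[/(_ [fset x]%fset)[[[_ irr] _] _] _] _ _] := M_generic.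
exact: irr [` fset11 x]%fset.
Qed.

Lemma generic_prec_irr : irreflexive (prec M).
Proof.
move=> x; have [[/(_ [fset x]%fset)[_ [irr _ _]] _] _ _] := M_generic.
exact: irr [` fset11 x]%fset.
Qed.

Lemma generic_prec_asym x y : prec M x y -> prec M y x = false.
Proof.
have [[/(_ [fset x; y]%fset)[_ [_ tr _]] _] _ _] := M_generic.
have xP : x \in [fset x; y]%fset by rewrite !inE eqxx.
have yP : y \in [fset x; y]%fset by rewrite !inE eqxx orbT.
move=> xy; apply/negP => yx.
have := tr [` yP]%fset [` xP]%fset [` xP]%fset xy yx.
by rewrite /= generic_prec_irr.
Qed.

(** The members of the chain serve: each finite set lies in one of them, and each is strong in all
    later ones by transitivity, hence strong in [M]. *)
Lemma strong_fset_cofinal D :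
  exists2 A, strong_in strong M A & (D `<=` A)%fset.
Proof.
have [_ [A [_ stA covA]] _] := M_generic.
have mono i j : (i <= j)%N -> fstrong (A i) (A j).
  move=> /subnK <-; elim: (j - i)%N => [|d IH]; last first.
    by apply: fstrong_trans IH _; apply/strong_fsetE; exact: stA.
  split=> // C sAC sCA; rewrite (_ : C = A i) //.
  by apply/eqP; rewrite eqEfsubset sAC sCA.
have [idx idxP] := choice covA.
have cof B : exists i, (B `<=` A i)%fset.
  exists (\max_(x : B) idx (val x)); apply/fsubsetP => x xB.
  have := leq_bigmax (F := fun x : B => idx (val x)) [` xB]%fset.
  by move=> /mono[/fsubsetP/(_ x (idxP x))].
have [i sDi] := cof D; exists (A i) => //; apply/strong_inE => B sAB.
have [j sBj] := cof (A i `|` B)%fset.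
have [ij|ji] := leqP i j.
  by have [_] := mono _ _ ij; apply => //; apply: fsubset_trans sBj; exact: fsubsetUr.
have [sji _] := mono _ _ (ltnW ji).
suff -> : B = A i by [].
apply/eqP; rewrite eqEfsubset sAB andbT; apply: fsubset_trans sji.
by apply: fsubset_trans sBj; exact: fsubsetUr.
Qed.

(** * Back-and-forth between strong finite subsets *)

(** Both maps are total, but only [f] on [A] and [h] on [B] matter. Keeping the inverse as data
    makes the notion symmetric, so that the back step is the forth step reversed. *)
Definition partial_iso A B (f h : T -> T) : Prop :=
  [/\ {in A, forall x, f x \in B /\ h (f x) = x},
      {in B, forall y, h y \in A /\ f (h y) = y},
      {in A &, {mono f : x y / adj M x y}},
      {in A &, {mono f : x y / prec M x y}} &
      strong_in strong M A /\ strong_in strong M B].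

Lemma partial_iso_sym A B f h : partial_iso A B f h -> partial_iso B A h f.
Proof.
move=> [fP hP fa fp [stA stB]]; split=> // x y /hP[xA fx] /hP[yA fy].
  by rewrite -fa // fx fy.
by rewrite -fp // fx fy.
Qed.

Definition extends A B (f h : T -> T) A' B' (f' h' : T -> T) : Prop :=
  [/\ (A `<=` A')%fset, (B `<=` B')%fset,
      {in A, f' =1 f} & {in B, h' =1 h}].

Lemma partial_iso_forth A B f h A' :
  partial_iso A B f h -> (A `<=` A')%fset -> strong_in strong M A' ->
  exists B' f' h', partial_iso A' B' f' h' /\ extends A B f h A' B' f' h'.
Proof.
move=> [fP hP fa fp [stA stB]] sA stA'.
have [[age _] _ ext] := M_generic.
have hA' (y : B) : h (val y) \in A'.
  by have [/(fsubsetP sA)] := hP _ (valP y).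
(* The extension property is applied to [B], embedded in [A'] by [h]; the resulting [g] embeds [A']
   strongly in [M] and extends [f]. *)
have [||g [[gI ga gp] gE stg]] :=
  ext B stB A' (substructure M A') (age A') (fun y => [` hA' y]%fset).
- split=> [x y /(congr1 val)/= E|x y|x y] /=.
  + by apply: val_inj; rewrite -(hP _ (valP x)).2 E (hP _ (valP y)).2.
  + have [xA fx] := hP _ (valP x); have [yA fy] := hP _ (valP y).
    by rewrite -[LHS]fa // fx fy.
  + have [xA fx] := hP _ (valP x); have [yA fy] := hP _ (valP y).
    by rewrite -[LHS]fp // fx fy.
- have [_] := stA A' sA; congr le_plus; apply/setP => x; rewrite inE.
  apply/idP/imsetP => [xA|[y _ ->]]; last by have [] := hP _ (valP y).
  have [fxB hx] := fP _ xA; exists [` fxB]%fset => //; exact: val_inj.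
(* Outside [A'] and the image of [g] the two maps are the identity, an arbitrary default. *)
pose f' x := if insub x is Some u then g u else x.
pose h' y := if [pick u : A' | g u == y] is Some u then val u else y.
have f'E (u : A') : f' (val u) = g u by rewrite /f' valK.
have h'E (u : A') : h' (g u) = val u.
  by rewrite /h'; case: pickP => [v /eqP/gI->|/(_ u)] //; rewrite eqxx.
have f'f : {in A, f' =1 f}.
  move=> x xA; have [fxB hx] := fP _ xA.
  by rewrite -[RHS](gE [` fxB]%fset) -f'E /= hx.
have sB : (B `<=` [fset g b | b : A'])%fset.
  apply/fsubsetP => y yB; rewrite -[y](gE [` yB]%fset).
  by apply/imfsetP; exists [` hA' [` yB]%fset]%fset.
exists [fset g b | b : A']%fset, f', h'; split; split=> //.
- move=> x xA'; rewrite -[x]/(val [` xA']%fset) f'E h'E; split=> //.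
  by apply/imfsetP; exists [` xA']%fset.
- by move=> _ /imfsetP[u _ ->]; rewrite h'E f'E; split=> //; exact: valP.
- move=> x y xA' yA'; rewrite -[x]/(val [` xA']%fset) -[y]/(val [` yA']%fset).
  by rewrite !f'E ga.
- move=> x y xA' yA'; rewrite -[x]/(val [` xA']%fset) -[y]/(val [` yA']%fset).
  by rewrite !f'E gp.
- move=> y yB; have [hyA fhy] := hP _ yB.
  by rewrite -{1}fhy -f'f // -[h y]/(val [` fsubsetP sA _ hyA]%fset) f'E h'E.
Qed.

Lemma extends_trans A B f h A' B' f' h' A'' B'' f'' h'' :
  extends A B f h A' B' f' h' -> extends A' B' f' h' A'' B'' f'' h'' ->
  extends A B f h A'' B'' f'' h''.
Proof.
move=> [sA sB fE hE] [sA' sB' fE' hE'].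
split; [exact: fsubset_trans sA'|exact: fsubset_trans sB'|move=> x xA|move=> x xB].
  by rewrite fE' ?fE // (fsubsetP sA).
by rewrite hE' ?hE // (fsubsetP sB).
Qed.

Lemma partial_iso_step A B f h x : partial_iso A B f h ->
  exists A' B' f' h', [/\ partial_iso A' B' f' h', extends A B f h A' B' f' h',
    x \in A' & x \in B'].
Proof.
move=> iso; have [A1 stA1 sA1] := strong_fset_cofinal (x |` A)%fset.
have xA1 : x \in A1 by apply: (fsubsetP sA1); rewrite fset1U1.
have [|B1 [f1 [h1 [iso1 ext1]]]] := partial_iso_forth iso _ stA1.
  exact: fsubset_trans (fsubsetU1 _ _) sA1.
have [B2 stB2 sB2] := strong_fset_cofinal (x |` B1)%fset.
have [|A2 [h2 [f2 [iso2 [? ? ? ?]]]]] :=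
  partial_iso_forth (partial_iso_sym iso1) _ stB2.
  exact: fsubset_trans (fsubsetU1 _ _) sB2.
have ext2 : extends A1 B1 f1 h1 A2 B2 f2 h2 by split.
exists A2, B2, f2, h2; split.
- exact: partial_iso_sym.
- exact: extends_trans ext2.
- by case: ext2 => /fsubsetP/(_ x xA1).
- by apply: (fsubsetP sB2); rewrite fset1U1.
Qed.

Record pisom := Pisom {
  pdom : {fset T}; pcod : {fset T}; pfun : T -> T; pinv : T -> T;
  pisomP : partial_iso pdom pcod pfun pinv }.

Definition pext (p q : pisom) : Prop :=
  extends (pdom p) (pcod p) (pfun p) (pinv p)
          (pdom q) (pcod q) (pfun q) (pinv q).

Lemma partial_iso_aut A B f h : partial_iso A B f h ->
  exists g : Aut M, {in A, g =1 f}.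
Proof.
move=> iso.
have /choice[step stepP] (px : pisom * T) : exists q,
    [/\ pext px.1 q, px.2 \in pdom q & px.2 \in pcod q].
  have [A' [B' [f' [h' [iso' ext xA xB]]]]] := partial_iso_step px.2 (pisomP px.1).
  by exists (Pisom iso').
(* Stage [n] absorbs the element with code [n] into domain and codomain, so [x] is handled from
   stage [N x], its code plus one, onwards. The automorphism is the limit of the stages. *)
pose next p n := if choice.unpickle n is Some x then step (p, x) else p.
pose fix s n := if n is m.+1 then next (s m) m else Pisom iso.
have extR p : pext p p by [].
have s_ext m n : (m <= n)%N -> pext (s m) (s n).
  move=> /subnK <-; elim: (n - m)%N => [|d IH] //=.
  apply: extends_trans IH _; rewrite /next.
  by case: (choice.unpickle _) => // x; have [] := stepP (s (d + m)%N, x).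
pose N (x : T) := (choice.pickle x).+1.
have inN x n : (N x <= n)%N -> x \in pdom (s n) /\ x \in pcod (s n).
  move=> /s_ext[/fsubsetP sA /fsubsetP sB _ _].
  suff [xA xB] : x \in pdom (s (N x)) /\ x \in pcod (s (N x)).
    by split; [exact: sA|exact: sB].
  by rewrite /N /= /next choice.pickleK; have [] := stepP (s (choice.pickle x), x).
pose g x := pfun (s (N x)) x; pose k x := pinv (s (N x)) x.
have gE x n : (N x <= n)%N -> g x = pfun (s n) x.
  by move=> /s_ext[_ _ E _]; rewrite E //; exact: (inN x _ (leqnn _)).1.
have kE x n : (N x <= n)%N -> k x = pinv (s n) x.
  by move=> /s_ext[_ _ _ E]; rewrite E //; exact: (inN x _ (leqnn _)).2.
have common x y : exists2 n, (N x <= n)%N & (N y <= n)%N.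
  by exists (maxn (N x) (N y)); rewrite (leq_maxl, leq_maxr).
have gP : is_automorphism M g.
  split=> [|x y|x y].
  - exists k => x.
      have [n xn yn] := common x (g x); have [fP _ _ _ _] := pisomP (s n).
      by rewrite (kE _ _ yn) (gE _ _ xn); exact: (fP x (inN _ _ xn).1).2.
    have [n xn yn] := common x (k x); have [_ hP _ _ _] := pisomP (s n).
    by rewrite (gE _ _ yn) (kE _ _ xn); exact: (hP x (inN _ _ xn).2).2.
  - have [n xn yn] := common x y; have [_ _ fa _ _] := pisomP (s n).
    by rewrite (gE _ _ xn) (gE _ _ yn); exact: fa (inN _ _ xn).1 (inN _ _ yn).1.
  - have [n xn yn] := common x y; have [_ _ _ fp _] := pisomP (s n).
    by rewrite (gE _ _ xn) (gE _ _ yn); exact: fp (inN _ _ xn).1 (inN _ _ yn).1.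
exists (mk_aut gP) => x xA; change (g x = f x).
by have [_ _ E _] := s_ext 0%N (N x) isT; exact: E.
Qed.

(** Sending the lower end to the lower end and the upper to the upper is a partial isomorphism
    between strong sets, so it extends to an automorphism. *)
Lemma strong_edges_conjugate a b a' b' :
  adj M a b -> prec M a b -> adj M a' b' -> prec M a' b' ->
  strong_in strong M [fset a; b]%fset -> strong_in strong M [fset a'; b']%fset ->
  exists g : Aut M, g a = a' /\ g b = b'.
Proof.
move=> eab pab eab' pab' st st'.
have ba x y : prec M x y -> (y == x) = false.
  by move=> pxy; apply/eqP => E; rewrite E generic_prec_irr in pxy.
pose f x := if x == a then a' else b'; pose h x := if x == a' then a else b.
have fa : f a = a' by rewrite /f eqxx.
have fb : f b = b' by rewrite /f (ba _ _ pab).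
have ha : h a' = a by rewrite /h eqxx.
have hb : h b' = b by rewrite /h (ba _ _ pab').
have inab x y z : z \in [fset x; y]%fset -> z = x \/ z = y.
  by rewrite !inE => /orP[] /eqP; [left|right].
have iso : partial_iso [fset a; b]%fset [fset a'; b']%fset f h.
  split=> //.
  - by move=> x /inab[]->; rewrite ?fa ?fb ?ha ?hb !inE !eqxx ?orbT.
  - by move=> x /inab[]->; rewrite ?fa ?fb ?ha ?hb ?fa ?fb !inE !eqxx ?orbT.
  - by move=> x y /inab[]-> /inab[]->; rewrite ?fa ?fb ?generic_adj_irr ?eab ?eab' //
      generic_adj_sym eab' generic_adj_sym eab.
  - by move=> x y /inab[]-> /inab[]->;
      rewrite ?fa ?fb ?generic_prec_irr ?pab ?pab' ?(generic_prec_asym pab) ?(generic_prec_asym pab').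
have [g gf] := partial_iso_aut iso.
by exists g; rewrite !gf ?fa ?fb // !inE eqxx ?orbT.
Qed.

(** The star is placed over the empty set, which is strong since all pre-dimensions are nonnegative.
    Its edges are strong in it, hence in [M] by transitivity. *)
Lemma strong_star_embedding (b : bool) (n : nat) : 1 <= alpha ->
  exists g : 'I_n.+1 -> T, embedding (star b n) M g /\
    forall i, i != ord0 -> strong_in strong M [fset g ord0; g i]%fset.
Proof.
move=> alpha_ge1; have [[age _] _ ext] := M_generic.
have st0 : strong_in strong M fset0.
  apply/strong_inE => B _; have [[_ d0] _] := age B.
  rewrite {1}/fdelta (_ : [set: fset0] = finset.set0); last by apply/setP => -[].
  apply: le_trans (d0 _).
  by rewrite /delta cards0 mulr0 sub0r oppr_le0 ler0n.
have fI : embedding (substructure M fset0) (star b n) (fun _ => ord0).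
  by split=> -[].
have [|g [[gI ga gp] _ stg]] := ext _ st0 _ _ (star_K_plus b n alpha_ge1) _ fI.
  move=> S _; have [[_ d0] _] := star_K_plus b n alpha_ge1.
  rewrite (_ : [set _ | _ : _] = finset.set0); last first.
    by apply/setP => x; rewrite inE; apply/imsetP => -[[]].
  by apply: le_trans (d0 _); rewrite /delta cards0 mulr0 sub0r oppr_le0 ler0n.
exists g; split=> // i i0; apply: fstrong_strong_in stg; split.
  apply/fsubsetP => x; rewrite !inE => /orP[] /eqP->; apply/imfsetP.
    by exists ord0.
  by exists i.
move=> C sC sCg.
have -> : [fset g ord0; g i]%fset = [fset g x | x in [set ord0; i]]%fset.
  apply/fsetP => x; rewrite !inE; apply/orP/imfsetP => [[]/eqP->|[y /=]].
  + by exists ord0; rewrite //= !inE eqxx.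
  + by exists i; rewrite //= !inE eqxx orbT.
  + by rewrite !inE => /orP[]/eqP-> ->; [left|right].
(* A set between the edge and the image of the star is the image of its preimage, so the comparison
   takes place in the star. *)
have -> : C = [fset g x | x in [set x | g x \in C]]%fset.
  apply/fsetP => x; apply/idP/imfsetP => [xC|[y /=]]; last by rewrite inE => yC ->.
  by have /imfsetP[y _ E] := fsubsetP sCg _ xC; exists y; rewrite //= inE -E.
rewrite !(fdelta_imfset _ gI ga); apply: star_edge_strong => //.
apply/fintype.subsetP => x; rewrite !inE => /orP[]/eqP->.
  by apply: (fsubsetP sC); rewrite !inE eqxx.
by apply: (fsubsetP sC); rewrite !inE eqxx orbT.
Qed.

End InfiniteStructure.

(** * The compact space of bounded orientations *)

Section Orientations.
Variables (T : choiceType) (M : structure T) (k : nat).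
Implicit Types (A B : {fset T}).

Local Notation space := (prod_topology (fun _ : (T * T)%type => bool)).
Implicit Types (o : space).

(** An edge may be directed both ways. Bounding finite sets of out-neighbours inside [A] makes the
    condition depend only on [o] over the finite square of [A], hence clopen. *)
Definition oriented_on A o : Prop :=
  {in A &, forall x y, adj M x y -> o (x, y) || o (y, x)} /\
  forall x B, x \in A -> (B `<=` A)%fset -> {in B, forall y, o (x, y)} ->
    (#|` B| <= k)%N.

Definition orientation : Type :=
  set_type ([set o | forall A, oriented_on A o]%classic : set space).

HB.instance Definition _ := Topological.on orientation.

Definition orients (o : orientation) (x y : T) : bool := (val o : space) (x, y).

Lemma orientationP (o : orientation) A : oriented_on A (val o).
Proof. exact: (set_valP o). Qed.

Lemma oriented_on_eq A o o' : {in A &, forall x y, o' (x, y) = o (x, y)} ->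
  oriented_on A o -> oriented_on A o'.
Proof.
move=> E [oE odeg]; split=> [x y xA yA exy|x B xA sBA oB].
  by rewrite !E //; exact: oE.
apply: (odeg x) => // y yB; rewrite -E //; first exact: oB.
exact: (fsubsetP sBA).
Qed.

Lemma oriented_onS A B o : (B `<=` A)%fset -> oriented_on A o -> oriented_on B o.
Proof.
move=> /fsubsetP sBA [oE odeg]; split=> [x y /sBA xA /sBA yA|x C /sBA xA sCB].
  exact: oE.
by apply: odeg => //; apply: fsubset_trans sCB _; apply/fsubsetP.
Qed.

Lemma near_coord o p : nbhs o [set o' : space | o' p = o p]%classic.
Proof.
exact: (@proj_continuous _ (fun _ : (T * T)%type => bool) p o _ (discrete_set1 _)).
Qed.

Lemma near_square o A :
  nbhs o [set o' : space | {in A &, forall x y, o' (x, y) = o (x, y)}]%classic.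
Proof.
have := @filter_bigI _ _ (A `*` A)%fset
  (fun p => [set o' : space | o' p = o p]%classic) _ (nbhs_filter o)
  (fun p _ => near_coord o p).
apply: filterS => o' E x y xA yA; apply: (E (x, y)).
by rewrite /= in_fsetM xA.
Qed.

(** Near a cluster point [o] some oriented [o'] agrees with it on the whole square of [A], so [o]
    inherits the condition. *)
Lemma cluster_oriented (F : set_system space) o A :
  F [set o' | oriented_on A o']%classic -> cluster F o -> oriented_on A o.
Proof.
move=> FA /(_ _ _ FA (near_square o A)) [o' [oA E]].
by apply: oriented_on_eq oA => x y xA yA; rewrite E.
Qed.

Lemma space_compact : compact [set: space]%classic.
Proof.
have := @tychonoff _ (fun _ : (T * T)%type => bool) (fun=> setT) (fun=> bool_compact).
by congr compact; apply/seteqP; split.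
Qed.

Lemma orientation_compact : compact [set: orientation]%classic.
Proof.
move=> F FF _.
(* A cluster point is found in the full product, shown to be an orientation, and then pulled back to
   the subspace. *)
have [o [_ oF]] := space_compact (fmap_proper_filter (val : orientation -> space) FF) filterT.
have oP : o \in [set o | forall A, oriented_on A o]%classic.
  apply/mem_set => A; apply: cluster_oriented oF.
  have FA : F [set o' : orientation | oriented_on A (val o')]%classic.
    by apply: filterE => o'; exact: orientationP.
  exact: FA.
exists (SigSub oP : orientation); split=> // U V FU [_ /= [[W oW <-] Wo WV]].
have [_ [[o' Uo' <-] Wo']] := oF (val @` U)%classic W
  (filterS (@preimage_image _ _ _ _) FU) (open_nbhs_nbhs (conj oW Wo)).
by exists o'; split=> //; exact: WV.
Qed.

Lemma orientation_hausdorff : hausdorff_space orientation.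
Proof.
move=> o o' oo'; apply: val_inj.
apply: (@hausdorff_product _ (fun _ : (T * T)%type => bool)) => [_|].
  exact: discrete_hausdorff.
move=> U V Uo Vo'.
have c (p : orientation) : {for p, continuous (val : orientation -> space)}.
  exact: initial_continuous.
have [q [Uq Vq]] := oo' _ _ (c o _ Uo) (c o' _ Vo').
by exists (val q).
Qed.

(** The sets [D A] are nonempty and directed under unions of the [A], so they generate a proper
    filter; any cluster point satisfies all the conditions. *)
Lemma orientation_nonempty : (forall A, exists o, oriented_on A o) ->
  ([set: orientation] !=set0)%classic.
Proof.
move=> ex.
pose D A := [set o | oriented_on A o]%classic.
have FF : Filter (filter_from setT D).
  apply: filter_from_filter; first by exists fset0.
  move=> A B _ _; exists (A `|` B)%fset => // o oAB.
  by split; apply: oriented_onS oAB; rewrite ?fsubsetUl ?fsubsetUr.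
have PF : ProperFilter (filter_from setT D).
  by apply: filter_from_proper => A _; exact: ex.
have [o [_ oF]] := space_compact PF filterT.
have oP : o \in [set o | forall A, oriented_on A o]%classic.
  by apply/mem_set => A; apply: cluster_oriented oF; exists A.
by exists (SigSub oP : orientation).
Qed.

Lemma cvg_orientation (F : set_system orientation) (o : orientation) : Filter F ->
  (forall x y, F [set o' | orients o' x y = orients o x y]%classic) -> (F --> o)%classic.
Proof.
move=> FF Fo U [_ /= [[V oV <-] Vo VU]].
have: (val @ F --> (val o : space))%classic.
  apply/cvg_sup => -[x y] W [_ /= [[Z oZ <-] Zg ZW]].
  suff: F [set o' : orientation | W (val o')]%classic by [].
  apply: filterS (Fo x y) => o' E; apply: ZW.
  by change (Z (orients o' x y)); rewrite E; exact: Zg.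
move=> /(_ V (open_nbhs_nbhs (conj oV Vo))) FV.
by apply: filterS VU _; exact: FV.
Qed.

Lemma near_orients (o : orientation) x y :
  nbhs o [set o' : orientation | orients o' x y = orients o x y]%classic.
Proof.
exact: (@initial_continuous _ _ (val : orientation -> space) o _ (near_coord _ (x, y))).
Qed.

(** * The action of the automorphism group on orientations *)

Fact act_subproof (g : Aut M) (o : orientation) :
  [set o | forall A, oriented_on A o]%classic
    ((fun p => orients o (autV g p.1) (autV g p.2)) : space).
Proof.
have [VK KV] := autVK g; have [_ va _] := autP (autV g).
move=> A; pose A' := [fset autV g x | x in A]%fset.
have [oE odeg] := orientationP o A'.
have inA' x : x \in A -> autV g x \in A' by move=> xA; apply/imfsetP; exists x.
split=> [x y xA yA exy|x B xA sBA oB] /=.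
  by apply: oE; rewrite ?inA' ?va.
rewrite (_ : #|` B| = #|` [fset autV g y | y in B]%fset|); last first.
  by rewrite card_imfset //; exact: can_inj KV.
apply: odeg (inA' x xA) _ _.
  by apply/fsubsetP => _ /imfsetP[y yB ->]; apply: inA'; exact: (fsubsetP sBA).
by move=> _ /imfsetP[y yB ->]; exact: oB.
Qed.

Definition orientation_act (g : Aut M) (o : orientation) : orientation :=
  SigSub (mem_set (act_subproof g o)).

Lemma orients_act g (o : orientation) x y :
  orients (orientation_act g o) x y = orients o (autV g x) (autV g y).
Proof. by []. Qed.

Lemma orientation_ext (o o' : orientation) : orients o =2 orients o' -> o = o'.
Proof. by move=> E; apply: val_inj; apply/funext => -[x y]; exact: E. Qed.

Lemma orientation_act_continuous : continuous_action orientation_act.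
Proof.
split.
- move=> o; apply: orientation_ext => x y; rewrite orients_act.
  by have [K _] := autVK (aut1 M); rewrite -{2}[x]K -{2}[y]K.
- move=> g h o; apply: orientation_ext => x y; rewrite !orients_act.
  have E z : autV (autM g h) z = autV h (autV g z).
    have [_ ghK] := autVK (autM g h).
    have [gK gK'] := autVK g; have [hK hK'] := autVK h.
    apply: (can_inj hK); rewrite hK'.
    by apply: (can_inj gK); rewrite gK'; exact: ghK.
  by rewrite -!E.
- case=> g o; apply: cvg_orientation => x y.
  (* The value at (x, y) involves only the inverse of [g] at two points and [o] at one pair, so it
     is locally constant. *)
  exists ([set g' : Aut M | autV g' x = autV g x /\ autV g' y = autV g y]%classic,
          [set o' | orients o' (autV g x) (autV g y) = orients o (autV g x) (autV g y)]%classic).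
    split; last exact: near_orients.
    have nV z : nbhs (g : Aut M) [set g' : Aut M | autV g' z = autV g z]%classic.
      exact: (@autV_continuous _ M g _ (near_aut (autV g) z)).
    by apply: filterI; exact: nV.
  by case=> g' o' [/= [Ex Ey] Eo]; rewrite /= !orients_act Ex Ey.
Qed.

End Orientations.

(** * Finite orientations inside the structure and the contradiction *)

Lemma orientation_exists (alpha : rat) (T : countType) (M : structure T) (k : nat) A :
  2 * alpha <= k%:R -> K_alpha alpha (adj (substructure M A)) ->
  exists o, oriented_on M k A o.
Proof.
move=> k_ge [[esym _] d0].
have [o [oE odeg]] := bounded_orientation k_ge d0 [set: A] esym.
exists (fun p => if (insub p.1, insub p.2) is (Some u, Some v) then o u v else false).
have E (x y : A) : (if (insub (val x), insub (val y)) is (Some u, Some v)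
    then o u v else false) = o x y by rewrite !valK.
split=> [x y xA yA exy|x B xA sBA oB] /=.
  rewrite (E [` xA]%fset [` yA]%fset) (E [` yA]%fset [` xA]%fset).
  by apply: oE; rewrite ?inE.
rewrite -(card_fsub sBA); apply: leq_trans (odeg [` xA]%fset).
apply/subset_leq_card/fintype.subsetP => y; rewrite !inE => yB.
by rewrite -E; exact: oB.
Qed.

Theorem theorem4p4 (alpha : rat) (alpha_ge1 : 1 <= alpha)
    (T : countType) (M : structure T)
    (M_generic : is_generic (K_plus alpha) (le_plus alpha) M) :
  ~ extremely_amenable (Aut M).
Proof.
move=> EA.
pose k := Num.bound (2 * alpha).
have k_ge : 2 * alpha <= k%:R.
  by apply/ltW/archi_boundP; rewrite mulr_ge0 // (le_trans ler01).
have [[age _] _ _] := M_generic.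
have [|o ofix] := EA _ (@orientation_act _ M k) _ (@orientation_compact _ _ _)
    (@orientation_hausdorff _ _ _) (@orientation_act_continuous _ _ _).
  apply: orientation_nonempty => A; have [KA _] := age A.
  exact: orientation_exists k_ge KA.
have inv (g : Aut M) x y : orients o (g x) (g y) = orients o x y.
  by rewrite -{1}(ofix g) orients_act !(autVK g).1.
(* A star on k + 2 vertices has k + 1 leaves, one more than an out-degree may be. *)
have few (f : 'I_k.+2 -> T) : injective f ->
    ~ forall i, i != ord0 -> orients o (f ord0) (f i).
  move=> fI of0; pose B := [fset f (lift ord0 i) | i : 'I_k.+1]%fset.
  have [_ odeg] := orientationP o (f ord0 |` B)%fset.
  have : (#|` B| <= k)%N.
    apply: (odeg (f ord0)); rewrite ?fset1U1 ?fsubsetU1 //.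
    by move=> _ /imfsetP[i _ ->]; apply: of0; rewrite eq_sym neq_lift.
  rewrite card_imfset /=; last by move=> i j /fI /lift_inj.
  by rewrite -cardE card_ord ltnn.
have [f [[fI fa fp] fst]] := strong_star_embedding M_generic true k.+1 alpha_ge1.
have [h [[hI ha hp] hst]] := strong_star_embedding M_generic false k.+1 alpha_ge1.
have fe i : i != ord0 -> adj M (f ord0) (f i) /\ prec M (f ord0) (f i).
  by move=> i0; rewrite fa fp /= (negPf i0) lt0n.
have he i : i != ord0 -> adj M (h i) (h ord0) /\ prec M (h i) (h ord0).
  by move=> i0; rewrite ha hp /= (negPf i0) lt0n.
have m0 : ord_max != ord0 :> 'I_k.+2 by [].
have [fmE fmP] := fe _ m0.
have [oE _] := orientationP o [fset f ord0; f ord_max]%fset.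
(* One reference edge decides for all strong edges: directed upwards, it overloads the star with its
   center below; directed downwards, the star with its center above. *)
have /orP[om|om] : orients o (f ord0) (f ord_max) || orients o (f ord_max) (f ord0).
  by apply: oE; rewrite ?inE ?eqxx ?orbT.
- apply: (few f fI) => i i0; have [fiE fiP] := fe _ i0.
  have [g [g0 gi]] :=
    strong_edges_conjugate M_generic fmE fmP fiE fiP (fst _ m0) (fst _ i0).
  by rewrite -g0 -gi inv.
- apply: (few h hI) => i i0; have [hiE hiP] := he _ i0.
  have st : strong_in (le_plus alpha) M [fset h i; h ord0]%fset.
    by rewrite fsetUC; exact: hst.
  have [g [g0 gi]] := strong_edges_conjugate M_generic fmE fmP hiE hiP (fst _ m0) st.
  by rewrite -g0 -gi inv.
Qed.
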